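(* For every $n\geq 2$, the group $A_n^+$ admits a presentation on the $2(n-1)$ generators $a_1,\ldots,a_{n-1},b_1,\ldots,b_{n-1}$, where $a_r=d_{r+1,r}$ and $b_r=e_{r+1,r}$ for $1\leq r\leq n-1$, in which every defining relator is a single commutator, that is, of the form $(p,q)$ for some words $p,q$ in the generators and their inverses.
   Context: Let $F_n$ be the free group of rank $n\geq 2$ with basis $x_1,\ldots,x_n$. For $1\leq j<i\leq n$, let $d_{i,j},e_{i,j}\in\operatorname{Aut}(F_n)$ be the automorphisms with $d_{i,j}(x_i)=x_ix_j$, $e_{i,j}(x_i)=x_jx_i$, and $d_{i,j}(x_k)=e_{i,j}(x_k)=x_k$ for $k\neq i$. Automorphisms are composed as functions: $(\alpha\beta)(x)=\alpha(\beta(x))$. Set $A_n^+=\langle d_{i,j},e_{i,j}\mid 1\leq j<i\leq n\rangle\leq\operatorname{Aut}(F_n)$. Commutators are $(x,y)=x^{-1}y^{-1}xy$. A presentation of a group on given elements means a set of relators (elements of the free group on one abstract generator for each listed element) such that the homomorphism from the abstract group so presented, sending each abstract generator to the corresponding element, is well defined and is an isomorphism. *)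

(* Defs.v *)
From HB Require Import structures.
From mathcomp Require Import all_boot.
From mathcomp Require Import mathcomp_extra boolp classical_sets.

Set Implicit Arguments.
Unset Strict Implicit.
Unset Printing Implicit Defensive.

Local Open Scope classical_set_scope.
Local Open Scope group_scope.

(* The letter (x, false) stands for x and (x, true) for x^-1.  Elements of the
   free group are the reduced words, so Leibniz equality is equality in the
   group. *)
Section Words.
Variable X : choiceType.
Implicit Types (a b : X * bool) (u v w : seq (X * bool)).

Definition linv a := (a.1, ~~ a.2).

Definition reduced w := sorted (fun a b => b != linv a) w.

Definition push a w :=
  if w is b :: w' then if b == linv a then w' else a :: w else [:: a].

Definition wmul u v := foldr push v u.
Definition winv w := rev (map linv w).

Lemma linvK : involutive linv.
Proof. by case=> x b; rewrite /linv /= negbK. Qed.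

Lemma reduced_cons a w : reduced (a :: w) -> reduced w.
Proof. exact: path_sorted. Qed.

Lemma push_reduced a w : reduced w -> reduced (push a w).
Proof.
case: w => [//|b w] /= rw; case: ifP => [_|/negbT ne] /=.
  exact: path_sorted rw.
by rewrite ne.
Qed.

Lemma push_cons a w : reduced (a :: w) -> push a w = a :: w.
Proof. by case: w => [//|b w] /= /andP[/negPf->]. Qed.

Lemma pushK a w : reduced w -> push a (push (linv a) w) = w.
Proof.
case: w => [_|b w rw] /=; first by rewrite eqxx.
rewrite linvK; case: eqP => [eb|_] /=; last by rewrite eqxx.
by rewrite eb in rw *; apply: push_cons.
Qed.

Lemma pushKV a w : reduced w -> push (linv a) (push a w) = w.
Proof. by move=> rw; rewrite -{2}[a]linvK pushK. Qed.

Lemma wmul_reduced u v : reduced v -> reduced (wmul u v).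
Proof. by move=> rv; elim: u => //= a u IH; apply: push_reduced. Qed.

Lemma wmul_push a u v : reduced u -> reduced v ->
  wmul (push a u) v = push a (wmul u v).
Proof.
case: u => [//|b u] ru rv /=; case: eqP => [->|//].
by rewrite pushK //; apply: wmul_reduced.
Qed.

Lemma wmulA u v w : reduced v -> reduced w ->
  wmul u (wmul v w) = wmul (wmul u v) w.
Proof.
move=> rv rw; elim: u => //= a u ->.
by rewrite wmul_push //; apply: wmul_reduced.
Qed.

Lemma wmul1 u : reduced u -> wmul u [::] = u.
Proof.
by elim: u => //= a u IH rw; rewrite IH ?push_cons //; apply: reduced_cons rw.
Qed.

Lemma winv_reduced w : reduced w -> reduced (winv w).
Proof.
rewrite /reduced /winv rev_sorted sorted_map; apply: sub_sorted => a b /=.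
by rewrite linvK eq_sym.
Qed.

Lemma wmulVw w : reduced w -> wmul (winv w) w = [::].
Proof.
rewrite /winv /wmul; elim: w => //= a w IH rw.
rewrite rev_cons -cats1 foldr_cat /= linvK eqxx.
by apply: IH; apply: reduced_cons rw.
Qed.

Lemma winvK : involutive winv.
Proof. by move=> w; rewrite /winv map_rev revK mapK //; apply: linvK. Qed.

Lemma wmulwV w : reduced w -> wmul w (winv w) = [::].
Proof. by move=> rw; rewrite -{1}[w]winvK wmulVw ?winv_reduced. Qed.

End Words.

Definition free_group (X : choiceType) := {w : seq (X * bool) | reduced w}.

Section FreeGroup.
Variable X : choiceType.
Local Notation F := (free_group X).

HB.instance Definition _ := Choice.on F.

Definition fg_one : F := exist _ [::] isT.
Definition fg_mul (u v : F) : F :=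
  exist _ (wmul (val u) (val v)) (wmul_reduced (val u) (valP v)).
Definition fg_inv (u : F) : F :=
  exist _ (winv (val u)) (winv_reduced (valP u)).

Lemma fg_mulA : associative fg_mul.
Proof. by move=> u v w; apply: val_inj; rewrite /= wmulA ?(valP v) ?(valP w). Qed.
Lemma fg_mul1g : left_id fg_one fg_mul.
Proof. by move=> u; apply: val_inj. Qed.
Lemma fg_mulg1 : right_id fg_one fg_mul.
Proof. by move=> u; apply: val_inj; rewrite /= wmul1 ?(valP u). Qed.
Lemma fg_mulVg : left_inverse fg_one fg_inv fg_mul.
Proof. by move=> u; apply: val_inj; rewrite /= wmulVw ?(valP u). Qed.
Lemma fg_mulgV : right_inverse fg_one fg_inv fg_mul.
Proof. by move=> u; apply: val_inj; rewrite /= wmulwV ?(valP u). Qed.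

HB.instance Definition _ :=
  isGroup.Build F fg_mulA fg_mul1g fg_mulg1 fg_mulVg fg_mulgV.

Definition fgen (x : X) : F := exist _ [:: (x, false)] isT.

End FreeGroup.

Section Lift.
Variables (X : choiceType) (G : groupType) (f : X -> G).

Definition leval (a : X * bool) : G := if a.2 then (f a.1)^-1 else f a.1.
Definition weval (w : seq (X * bool)) : G := \prod_(a <- w) leval a.

Definition fg_lift (u : free_group X) : G := weval (val u).

Lemma leval_inv a : leval (linv a) = (leval a)^-1.
Proof. by case: a => x [] //=; rewrite /leval /= invgK. Qed.

Lemma weval_push a w : weval (push a w) = leval a * weval w.
Proof.
case: w => [|b w] /=; first by rewrite /weval big_seq1 big_nil mulg1.
case: eqP => [->|_]; last by rewrite /weval !big_cons.
by rewrite /weval big_cons leval_inv mulVKg.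
Qed.

Lemma weval_wmul u v : weval (wmul u v) = weval u * weval v.
Proof.
elim: u => [|a u IH] /=; first by rewrite /weval big_nil mul1g.
by rewrite weval_push IH /weval big_cons mulgA.
Qed.

Lemma fg_liftM : {morph fg_lift : u v / u * v}.
Proof. by move=> u v; rewrite /fg_lift weval_wmul. Qed.

HB.instance Definition _ :=
  isMultiplicative.Build (free_group X) G fg_lift fg_liftM.

Lemma fg_lift_gen x : fg_lift (fgen x) = f x.
Proof. by rewrite /fg_lift /weval big_seq1. Qed.

End Lift.

Lemma morph_inv (G H : groupType) (f : {multiplicative G -> H}) (x : G) :
  f x^-1 = (f x)^-1.
Proof.
have f1 : f 1 = 1 by apply: (mulgI (f 1)); rewrite -gmulfM !mulg1.
by apply: (mulgI (f x)); rewrite -gmulfM !mulgV.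
Qed.

Lemma fg_ext (X : choiceType) (G : groupType)
    (f g : {multiplicative (free_group X) -> G}) :
  (forall x, f (fgen x) = g (fgen x)) -> f =1 g.
Proof.
have f1 (h : {multiplicative (free_group X) -> G}) : h 1 = 1.
  by apply: (mulgI (h 1)); rewrite -gmulfM !mulg1.
move=> fg [w rw]; elim: w rw => [|[x b] w IH] rw.
  have -> : exist _ [::] rw = 1 :> free_group X by apply: val_inj.
  by rewrite !f1.
pose l : free_group X := if b then (fgen x)^-1 else fgen x.
have -> : exist _ ((x, b) :: w) rw = l * exist _ w (reduced_cons rw)
    :> free_group X.
  by apply: val_inj; rewrite /= -[LHS](push_cons rw) /l; case: (b).
rewrite !gmulfM IH; congr (_ * _).
by rewrite /l; case: (b); rewrite ?morph_inv fg.
Qed.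

Section Aut.
Variable G : groupType.

Definition is_aut (f : G -> G) : Prop :=
  bijective f /\ {morph f : x y / x * y}.

Definition Aut := {f : G -> G | `[< is_aut f >]}.

HB.instance Definition _ := gen_eqMixin Aut.
HB.instance Definition _ := gen_choiceMixin Aut.

Definition aut_fun (a : Aut) : G -> G := sval a.
Coercion aut_fun : Aut >-> Funclass.

Definition mkAut (f : G -> G) (fP : is_aut f) : Aut := exist _ f (asboolT fP).

Lemma autP (a : Aut) : is_aut a.
Proof. exact: asboolW (svalP a). Qed.

Lemma aut_ext (a b : Aut) : a =1 b -> a = b.
Proof.
case: a b => [f pf] [g pg] /= /funext fg; apply: eq_exist; exact: fg.
Qed.

Lemma is_aut_id : is_aut idfun.
Proof. by split; first by exists idfun. Qed.

Lemma is_aut_comp (a b : Aut) : is_aut (a \o b).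
Proof.
have [[ba ma] [bb mb]] := (autP a, autP b).
by split; [exact: bij_comp | move=> x y /=; rewrite mb ma].
Qed.

Lemma aut_inv_subproof (a : Aut) :
  {g : G -> G | cancel a g /\ cancel g a}.
Proof. by apply: cid; have [[g ag ga] _] := autP a; exists g. Qed.

Lemma is_aut_inv (a : Aut) : is_aut (sval (aut_inv_subproof a)).
Proof.
case: aut_inv_subproof => g [ag ga] /=; split; first by exists a.
by move=> x y; apply: (can_inj ag); rewrite (proj2 (autP a)) !ga.
Qed.

Definition aut_one := mkAut is_aut_id.
Definition aut_mul a b := mkAut (is_aut_comp a b).
Definition aut_inv a := mkAut (is_aut_inv a).

Lemma aut_mulA : associative aut_mul.
Proof. by move=> a b c; apply: aut_ext. Qed.
Lemma aut_mul1g : left_id aut_one aut_mul.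
Proof. by move=> a; apply: aut_ext. Qed.
Lemma aut_mulg1 : right_id aut_one aut_mul.
Proof. by move=> a; apply: aut_ext. Qed.
Lemma aut_mulVg : left_inverse aut_one aut_inv aut_mul.
Proof.
by move=> a; apply: aut_ext => x /=; case: aut_inv_subproof => g [ag _] /=.
Qed.
Lemma aut_mulgV : right_inverse aut_one aut_inv aut_mul.
Proof.
by move=> a; apply: aut_ext => x /=; case: aut_inv_subproof => g [_ ga] /=.
Qed.

HB.instance Definition _ :=
  isGroup.Build Aut aut_mulA aut_mul1g aut_mulg1 aut_mulVg aut_mulgV.

Lemma aut_mulE (a b : Aut) x : aut_fun (a * b) x = a (b x).
Proof. by []. Qed.

End Aut.

Section Subgroups.
Variable G : groupType.
Implicit Types (S H : set G).

Definition is_subgroup H : Prop :=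
  [/\ H 1, forall x y, H x -> H y -> H (x * y) & forall x, H x -> H x^-1].

Definition is_normal_subgroup H : Prop :=
  is_subgroup H /\ forall x y, H x -> H (x ^ y).

Definition generated S : set G :=
  \bigcap_(H in [set H | is_subgroup H /\ S `<=` H]) H.

Definition normal_closure S : set G :=
  \bigcap_(H in [set H | is_normal_subgroup H /\ S `<=` H]) H.

Lemma normal_closureP S : is_normal_subgroup (normal_closure S).
Proof.
split; first split.
- by move=> H [[[]]].
- by move=> x y Nx Ny H HP; have [[[_ HM _] _] _] := HP; exact: HM (Nx H HP) (Ny H HP).
- by move=> x Nx H HP; have [[[_ _ HV] _] _] := HP; exact: HV (Nx H HP).
- by move=> x y Nx H HP; have [[_ HJ] _] := HP; exact: HJ (Nx H HP).
Qed.

Lemma sub_normal_closure S : S `<=` normal_closure S.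
Proof. by move=> x Sx H [_]; apply. Qed.

End Subgroups.

Section Presented.
Variables (X : choiceType) (R : set (free_group X)).
Local Notation F := (free_group X).
Local Notation N := (normal_closure R).

Definition rel_eq : rel F := fun u v => `[< N (u^-1 * v) >].

Lemma rel_eq_refl : reflexive rel_eq.
Proof.
move=> u; apply/asboolP; rewrite mulVg.
by have [[N1 _ _] _] := normal_closureP R.
Qed.

Lemma rel_eq_sym : symmetric rel_eq.
Proof.
have [[_ _ NV] _] := normal_closureP R.
by move=> u v; apply/asboolP/asboolP => /NV; rewrite invgM invgK.
Qed.

Lemma rel_eq_trans : transitive rel_eq.
Proof.
have [[_ NM _] _] := normal_closureP R.
move=> v u w /asboolP Nuv /asboolP Nvw; apply/asboolP.
by have := NM _ _ Nuv Nvw; rewrite mulgA mulgK.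
Qed.

Canonical rel_eq_equiv := EquivRel rel_eq rel_eq_refl rel_eq_sym rel_eq_trans.

Definition presented := {eq_quot rel_eq}%qT.

HB.instance Definition _ := Choice.on presented.
HB.instance Definition _ := EqQuotient.on presented.

Definition pr_proj (u : F) : presented := (\pi_presented u)%qT.

Definition pr_mul (x y : presented) := pr_proj (repr x * repr y).
Definition pr_inv (x : presented) := pr_proj (repr x)^-1.

Lemma pr_projP u v : pr_proj u = pr_proj v <-> N (u^-1 * v).
Proof.
by split=> [/eqquotP/asboolP|Nuv] //; apply/eqquotP; apply/asboolP.
Qed.

Lemma pr_reprK x : pr_proj (repr x) = x.
Proof. exact: reprK. Qed.

Lemma pr_projM : {morph pr_proj : u v / u * v >-> pr_mul u v}.
Proof.
have [[_ NM NV] NJ] := normal_closureP R.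
move=> u v; apply/pr_projP.
have /pr_projP Nu : pr_proj u = pr_proj (repr (pr_proj u)) by rewrite pr_reprK.
have /pr_projP Nv : pr_proj v = pr_proj (repr (pr_proj v)) by rewrite pr_reprK.
have := NM _ _ (NJ _ v Nu) Nv.
by rewrite conjgE invgM !mulgA mulgK.
Qed.

Lemma pr_projV u : pr_inv (pr_proj u) = pr_proj u^-1.
Proof.
have [[_ NM NV] NJ] := normal_closureP R.
have /pr_projP Nu : pr_proj u = pr_proj (repr (pr_proj u)) by rewrite pr_reprK.
apply/pr_projP; rewrite invgK.
by have := NJ _ (u^-1) Nu; rewrite conjgE invgK !mulgA mulgV mul1g.
Qed.

Lemma pr_mulA : associative pr_mul.
Proof.
move=> x y z; rewrite -[x]pr_reprK -[y]pr_reprK -[z]pr_reprK.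
by rewrite -!pr_projM mulgA.
Qed.
Lemma pr_mul1g : left_id (pr_proj 1) pr_mul.
Proof. by move=> x; rewrite -[x]pr_reprK -pr_projM mul1g. Qed.
Lemma pr_mulg1 : right_id (pr_proj 1) pr_mul.
Proof. by move=> x; rewrite -[x]pr_reprK -pr_projM mulg1. Qed.
Lemma pr_mulVg : left_inverse (pr_proj 1) pr_inv pr_mul.
Proof. by move=> x; rewrite -[x]pr_reprK pr_projV -pr_projM mulVg. Qed.
Lemma pr_mulgV : right_inverse (pr_proj 1) pr_inv pr_mul.
Proof. by move=> x; rewrite -[x]pr_reprK pr_projV -pr_projM mulgV. Qed.

HB.instance Definition _ :=
  isGroup.Build presented pr_mulA pr_mul1g pr_mulg1 pr_mulVg pr_mulgV.

Definition pr_gen (x : X) : presented := pr_proj (fgen x).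

End Presented.

(* [R] presents the subgroup [H] of [G] on the elements [g x], x in X; a
   homomorphism into G that is injective with image H is an isomorphism onto H,
   and its existence says that x |-> g x is well defined on < X | R >. *)
Definition presents (X : choiceType) (R : set (free_group X))
    (G : groupType) (H : set G) (g : X -> G) : Prop :=
  exists phi : {multiplicative (presented R) -> G},
    [/\ forall x, phi (pr_gen R x) = g x, injective phi & range phi = H].

(* The basis x_1, ..., x_n is indexed by 'I_n, so x_k is [fgen (k-1)]. *)
Section Aplus.
Variable n : nat.
Local Notation F := (free_group 'I_n).
Local Notation x := (@fgen 'I_n).

Definition subst1 (i : 'I_n) (u : F) : F -> F :=
  fg_lift (fun k => if k == i then u else x k).

HB.instance Definition _ i u := Multiplicative.on (subst1 i u).

Lemma subst1_eq i u : subst1 i u (x i) = u.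
Proof. by rewrite /subst1 fg_lift_gen eqxx. Qed.

Lemma subst1_neq i u k : k != i -> subst1 i u (x k) = x k.
Proof. by rewrite /subst1 fg_lift_gen => /negPf->. Qed.

Lemma subst1K i u v : subst1 i v u = x i -> cancel (subst1 i u) (subst1 i v).
Proof.
move=> vu w; rewrite -[RHS]/(idfun w).
apply: (@fg_ext _ _ (subst1 i v \o subst1 i u) idfun) => k /=.
have [->|ne] := eqVneq k i; first by rewrite subst1_eq.
by rewrite !subst1_neq.
Qed.

Section Pair.
Variables (i j : 'I_n) (lt_ji : (j < i)%N).

Let ne_ji : j != i.
Proof. by rewrite -val_eqE /= neq_ltn lt_ji. Qed.

Lemma d_is_aut : is_aut (subst1 i (x i * x j)).
Proof.
split; last exact: gmulfM.
exists (subst1 i (x i * (x j)^-1)); apply: subst1K;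
  by rewrite gmulfM ?morph_inv /= subst1_eq subst1_neq // ?mulgK ?mulgVK.
Qed.

Lemma e_is_aut : is_aut (subst1 i (x j * x i)).
Proof.
split; last exact: gmulfM.
exists (subst1 i ((x j)^-1 * x i)); apply: subst1K;
  by rewrite gmulfM ?morph_inv /= subst1_eq subst1_neq // ?mulKg ?mulVKg.
Qed.

Definition d_aut : Aut F := mkAut d_is_aut.
Definition e_aut : Aut F := mkAut e_is_aut.

End Pair.

Definition Aplus : set (Aut F) :=
  generated [set a | exists (i j : 'I_n) (lt_ji : (j < i)%N),
                       a = d_aut lt_ji \/ a = e_aut lt_ji].

Lemma ord_lo_proof (r : 'I_n.-1) : (r < n)%N.
Proof. exact: leq_trans (ltn_ord r) (leq_pred n). Qed.

Lemma ord_hi_proof (r : 'I_n.-1) : (r.+1 < n)%N.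
Proof. by rewrite -ltn_predRL ltn_ord. Qed.

Definition ord_lo (r : 'I_n.-1) : 'I_n := Ordinal (ord_lo_proof r).
Definition ord_hi (r : 'I_n.-1) : 'I_n := Ordinal (ord_hi_proof r).

Lemma ord_lo_hi (r : 'I_n.-1) : (ord_lo r < ord_hi r)%N.
Proof. exact: ltnSn. Qed.

Definition a_gen (r : 'I_n.-1) : Aut F := d_aut (ord_lo_hi r).
Definition b_gen (r : 'I_n.-1) : Aut F := e_aut (ord_lo_hi r).

Definition ab_gen (s : 'I_n.-1 + 'I_n.-1) : Aut F :=
  match s with inl r => a_gen r | inr r => b_gen r end.

End Aplus.

(* Main.v *)
From HB Require Import structures.
Require Import Defs.
From mathcomp Require Import all_boot.
From mathcomp Require Import mathcomp_extra boolp classical_sets.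

(** The relators are all the commutators of two words whose images in Aut(F_n)
    commute.  In the group G so presented, two elements commute as soon as
    their images do, and the whole matter is to show that this property forces
    the map phi from G to Aut(F_n) to be injective.

    The image is an iterated semidirect product: with F_(<i) the subgroup
    generated by the x_k with k < i, its i-th layer is the product of two
    copies of F_(<i), acting by x_i |-> x_i u and x_i |-> u^-1 x_i ([transv]),
    and the automorphisms of the lower layers act on both copies through their
    action on F_(<i) ([lower_transvJ]).  So everything follows from lifting to
    G the transvections with u = x_j together with the action of the
    generators a_r and b_r on them ([rootJ]).  Most of these relations say that
    two elements commute, and hold in G for free.  The others concern
    k = r + 1 and l = r, where a_r and b_r map x_k to x_k x_l and x_l x_k.
    Let p and q be the lifts for u = x_k and u = x_l.
    - a p a^-1 = p q is achieved by defining q as the commutator (p, a^-1);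
      starting from the generators this defines all the lifts ([root]).
    - b p b^-1 = q p is then a consequence of commutations: b a^-1 maps x_k to
      x_l x_k x_l^-1, hence q^-1 b a^-1 commutes with p in Aut(F_n), so also
      in G ([commutator_twist]).

    These relations move the lower layers of any element of G to the right,
    which brings it to a normal form ([normal_form_lift]).  A normal form that
    acts trivially is trivial: its lower layers are determined by the action on
    F_(<i), and v x_i u = x_i with u and v in F_(<i) forces u = v = 1 in a free
    group ([transv_indep]). *)

Set Implicit Arguments.
Unset Strict Implicit.
Unset Printing Implicit Defensive.

Local Open Scope group_scope.

(** * Morphisms and automorphisms of free groups *)

Lemma morph1 (G H : groupType) (f : {multiplicative G -> H}) : f 1 = 1.
Proof. by apply: (mulgI (f 1)); rewrite -gmulfM !mulg1. Qed.

Lemma fg_lift_in (X : choiceType) (G : groupType) (H : set G) (f : X -> G) u :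
  is_subgroup H -> (forall x, H (f x)) -> H (fg_lift f u).
Proof.
case=> H1 HM HV Hf; rewrite /fg_lift /weval; elim/big_ind: _ => //.
by case=> x [] _; [apply/HV/Hf | apply: Hf].
Qed.

Lemma fg_subgroup_full (X : choiceType) (H : set (free_group X)) :
  is_subgroup H -> (forall x, H (fgen x)) -> forall u, H u.
Proof.
move=> Hs Hx u; have <- : fg_lift (@fgen X) u = u; last exact: fg_lift_in.
by apply: (fg_ext (g := idfun)) => x; rewrite /= fg_lift_gen.
Qed.

(* Otherwise simplification would expose the substitution underlying an
   automorphism and hide the automorphism from the lemmas about it. *)
Arguments aut_fun : simpl never.

HB.instance Definition _ (G : groupType) (a : Aut G) :=
  isMultiplicative.Build G G (aut_fun a) (autP a).2.

Lemma autM (G : groupType) (a : Aut G) u v : a (u * v) = a u * a v.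
Proof. exact: gmulfM. Qed.

Lemma autV (G : groupType) (a : Aut G) u : a u^-1 = (a u)^-1.
Proof. exact: morph_inv. Qed.

Lemma aut1 (G : groupType) (a : Aut G) : a 1 = 1.
Proof. exact: morph1. Qed.

Lemma aut_gen_ext (X : choiceType) (a b : Aut (free_group X)) :
  (forall x, a (fgen x) = b (fgen x)) -> a = b.
Proof. by move=> ab; apply: aut_ext; apply: fg_ext. Qed.

(** * Transvections *)

Section Transvections.
Variable n : nat.
Local Notation F := (free_group 'I_n).
Local Notation x := (@fgen 'I_n).
Implicit Types (i j k : 'I_n) (u v : F) (h : Aut F).

(** The retraction of F_n onto F_(<i).  Composing with it makes transvections,
    and later their lifts, total functions on F_n, which can be compared on the
    basis; membership of u in F_(<i) becomes [low_part i u = u]. *)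
Definition low_part (i : 'I_n) : F -> F :=
  fg_lift (fun k => if (k < i)%N then x k else 1).

HB.instance Definition _ i := Multiplicative.on (low_part i).

Lemma low_part_lt i k : (k < i)%N -> low_part i (x k) = x k.
Proof. by move=> ki; rewrite /low_part fg_lift_gen ki. Qed.

Lemma low_part_ge i k : (i <= k)%N -> low_part i (x k) = 1.
Proof. by move=> ik; rewrite /low_part fg_lift_gen ltnNge ik. Qed.

Lemma hom_low_part (f : {multiplicative F -> F}) i u :
  (forall k, (k < i)%N -> f (x k) = x k) -> f (low_part i u) = low_part i u.
Proof.
move=> fx; apply: (fg_ext (f := f \o low_part i)) => k /=.
case: (ltnP k i) => ki; first by rewrite low_part_lt ?fx.
by rewrite low_part_ge ?morph1.
Qed.

Lemma low_partK i u : low_part i (low_part i u) = low_part i u.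
Proof. by apply: hom_low_part => k; apply: low_part_lt. Qed.

(** The inverse on the left-hand side makes both families of transvections
    homomorphisms in u, so that they can be treated uniformly. *)
Definition transv_val t i u :=
  if t then (low_part i u)^-1 * x i else x i * low_part i u.

Lemma transv_is_aut t i u : is_aut (subst1 i (transv_val t i u)).
Proof.
have low v w : subst1 i v (low_part i w) = low_part i w.
  by apply: hom_low_part => k ki /=; rewrite subst1_neq // -val_eqE neq_ltn ki.
split; last exact: gmulfM.
exists (subst1 i (transv_val t i u^-1)); apply: subst1K; rewrite /transv_val;
  case: t; rewrite gmulfM !morph_inv /= subst1_eq low ?invgK;
  by rewrite ?mulgK ?mulgVK ?mulKg ?mulVKg.
Qed.

Definition transv t i u : Aut F := mkAut (transv_is_aut t i u).

Lemma transv_eq t i u : transv t i u (x i) = transv_val t i u.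
Proof. exact: subst1_eq. Qed.

Lemma transv_neq t i u k : k != i -> transv t i u (x k) = x k.
Proof. exact: subst1_neq. Qed.

Lemma transv_low t i u v : transv t i u (low_part i v) = low_part i v.
Proof.
apply: (hom_low_part (f := aut_fun (transv t i u))) => k ki.
by apply: transv_neq; rewrite -val_eqE neq_ltn ki.
Qed.

(** A transvection of x_i fixes F_(<i), which contains the multiplier. *)
Lemma transvM t i : {morph transv t i : u v / u * v}.
Proof.
move=> u v; apply: aut_gen_ext => k; rewrite aut_mulE.
have [->|ki] := eqVneq k i; last by rewrite !transv_neq.
rewrite !transv_eq /transv_val gmulfM; case: t.
  by rewrite autM autV transv_low transv_eq invgM mulgA.
by rewrite autM transv_low transv_eq mulgA.
Qed.

HB.instance Definition _ t i :=
  isMultiplicative.Build F (Aut F) (transv t i) (@transvM t i).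

Lemma transv_comm i u v : commute (transv false i u) (transv true i v).
Proof.
apply: aut_gen_ext => k; rewrite !aut_mulE.
have [->|ki] := eqVneq k i; last by rewrite !transv_neq.
by rewrite !transv_eq !autM autV !transv_low !transv_eq mulgA.
Qed.

(** The automorphisms that come from Aut(F_(<i)): commuting with the
    retraction says that F_(<i) is preserved. *)
Definition lower_aut i h : Prop :=
  (forall k, (i <= k)%N -> h (x k) = x k) /\
  (forall u, h (low_part i u) = low_part i (h u)).

Lemma lower_aut_subgroup i : is_subgroup (lower_aut i).
Proof.
split=> //.
- move=> g h [gx gl] [hx hl]; split=> [k ik|u]; rewrite !aut_mulE.
    by rewrite hx ?gx.
  by rewrite hl gl.
- move=> h [hx hl]; have hK : cancel (aut_fun h) (aut_fun h^-1).
    by move=> u; rewrite -aut_mulE mulVg.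
  have hKV : cancel (aut_fun h^-1) (aut_fun h).
    by move=> u; rewrite -aut_mulE mulgV.
  split=> [k ik|u]; first by rewrite -{1}(hx k) ?hK.
  by apply: (can_inj hK); rewrite hl !hKV.
Qed.

Lemma lower_transv t i j u : (j < i)%N -> lower_aut i (transv t j u).
Proof.
move=> ji; split=> [k ik|v].
  by rewrite transv_neq // -val_eqE neq_ltn (leq_trans ji ik) orbT.
apply: (fg_ext (f := aut_fun (transv t j u) \o low_part i)
               (g := low_part i \o aut_fun (transv t j u))) => k /=.
have low w : low_part i (low_part j w) = low_part j w.
  by apply: hom_low_part => l lj; apply: low_part_lt; apply: ltn_trans ji.
case: (ltnP k i) => ki.
  rewrite low_part_lt //; have [->|kj] := eqVneq k j.
    by rewrite transv_eq /transv_val; case: t;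
      rewrite gmulfM ?morph_inv /= low low_part_lt.
  by rewrite transv_neq // low_part_lt.
by rewrite low_part_ge // aut1 transv_neq ?low_part_ge //
   -val_eqE neq_ltn (leq_trans ji ki) orbT.
Qed.

(** The semidirect product structure: both sides send x_i to its product with
    h u, and agree with h elsewhere because h maps F_(<i) into itself. *)
Lemma lower_transvJ t i h u : lower_aut i h ->
  h * transv t i u = transv t i (h u) * h.
Proof.
move=> [hx hl]; apply: aut_gen_ext => k; rewrite !aut_mulE.
have [->|ki] := eqVneq k i.
  rewrite hx // !transv_eq /transv_val -hl; case: t;
    by rewrite autM ?autV hx.
rewrite transv_neq //; case: (ltnP k i) => [lt_ki|le_ik].
  by rewrite -{2}(low_part_lt lt_ki) hl transv_low -hl low_part_lt.
by rewrite hx // transv_neq.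
Qed.

Lemma d_transv i j (ji : (j < i)%N) : d_aut ji = transv false i (x j).
Proof.
apply: aut_gen_ext => k; have [->|ki] := eqVneq k i.
  by rewrite transv_eq /transv_val low_part_lt //; apply: subst1_eq.
by rewrite transv_neq //; apply: subst1_neq.
Qed.

Lemma e_transv i j (ji : (j < i)%N) : e_aut ji = (transv true i (x j))^-1.
Proof.
rewrite -morph_inv.
apply: aut_gen_ext => k; have [->|ki] := eqVneq k i.
  by rewrite transv_eq /transv_val morph_inv /= low_part_lt ?invgK //;
     apply: subst1_eq.
by rewrite transv_neq //; apply: subst1_neq.
Qed.

End Transvections.

(** * Independence of left and right multiplications *)

Section Avoidance.
Variable X : choiceType.
Implicit Types (y : X) (u v w : seq (X * bool)).

Lemma wmul_cat u v : reduced (u ++ v) -> wmul u v = u ++ v.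
Proof.
elim: u => //= a u IH r; rewrite IH ?push_cons //; exact: reduced_cons r.
Qed.

Definition avoids y : set (free_group X) :=
  fun g => all (fun a => a.1 != y) (val g).

Lemma avoids_subgroup y : is_subgroup (avoids y).
Proof.
split=> // [[u ru] [v rv]|[u ru]]; rewrite /avoids /=.
  move=> + vy; elim: u {ru} => //= a u IH /andP[ay /IH].
  by case: (wmul u v) => [|b w] /=; rewrite ?ay // => /andP[bly wy];
     case: ifP; rewrite //= ay bly.
by rewrite all_rev all_map; apply: sub_all.
Qed.

(** Both products are reduced as they stand, so they are equal as words; one
    ends with y, the other begins with it, and y occurs nowhere else. *)
Lemma avoids_cross y (w z : free_group X) : avoids y w -> avoids y z ->
  w * fgen y = fgen y * z -> w = 1 /\ z = 1.
Proof.
move: w z => [w rw] [z rz]; rewrite /avoids /= => wy zy /(congr1 val) /=.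
have push_y : push (y, false) z = (y, false) :: z.
  apply: push_cons; case: z zy rz => [//|b z] /= /andP[by_ _] ->.
  by rewrite andbT; apply: contraNneq by_ => ->.
rewrite push_y wmul_cat; last first.
  case: w wy rw => [//|a w] wy; rewrite /reduced /= cat_path => -> /=.
  rewrite andbT; have : last a w \in a :: w by apply: mem_last.
  by move=> /(allP wy); apply: contraNneq => /(congr1 fst) /= ->.
case: w rw wy => [|a w] rw /=.
  by move=> _ [ez]; split; apply: val_inj => //=; rewrite -ez.
by move=> /andP[ay _] [ea]; rewrite ea eqxx in ay.
Qed.

End Avoidance.

(** At x_i the hypothesis reads v^-1 x_i u = x_i with u and v free of x_i. *)
Lemma transv_indep n (i : 'I_n) (u v : free_group 'I_n) :
  transv false i u * transv true i v = 1 ->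
  low_part i u = 1 /\ low_part i v = 1.
Proof.
move=> /(congr1 (fun a : Aut _ => a (fgen i))).
rewrite aut_mulE transv_eq /transv_val autM autV transv_low transv_eq.
move=> /= eq1.
have low_avoids w : avoids i (low_part i w).
  apply: fg_lift_in => [|k]; first exact: avoids_subgroup.
  case: ifP => // ki; rewrite /avoids /= andbT -val_eqE.
  by rewrite neq_ltn ki.
have {}eq1 : low_part i v * fgen i = fgen i * low_part i u.
  by apply: (mulgI (low_part i v)^-1); rewrite mulKg.
by have [] := avoids_cross (low_avoids _) (low_avoids _) eq1.
Qed.

(** * The consecutive generators *)

Section ConsecutiveGenerators.
Variable n : nat.
Local Notation x := (@fgen 'I_n).
Implicit Types (r : 'I_n.-1) (i j k : 'I_n).

Definition gen_row (s : 'I_n.-1 + 'I_n.-1) : 'I_n.-1 :=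
  match s with inl r => r | inr r => r end.

Lemma a_gen_hi r : a_gen r (x (ord_hi r)) = x (ord_hi r) * x (ord_lo r).
Proof. exact: subst1_eq. Qed.

Lemma b_gen_hi r : b_gen r (x (ord_hi r)) = x (ord_lo r) * x (ord_hi r).
Proof. exact: subst1_eq. Qed.

Lemma ab_gen_neq s k : k != ord_hi (gen_row s) -> ab_gen s (x k) = x k.
Proof. by case: s => r; apply: subst1_neq. Qed.

Lemma ord_lo_neq r : ord_lo r != ord_hi r.
Proof. by rewrite -val_eqE neq_ltn ltnSn. Qed.

Lemma ab_gen_lo s : ab_gen s (x (ord_lo (gen_row s))) = x (ord_lo (gen_row s)).
Proof. exact: ab_gen_neq (ord_lo_neq _). Qed.

Lemma lower_ab_gen i s : (ord_hi (gen_row s) < i)%N -> lower_aut i (ab_gen s).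
Proof.
case: s => r /= ri; rewrite /a_gen /b_gen ?d_transv ?e_transv -?morph_inv;
  exact: lower_transv.
Qed.

Lemma ord_lo_surj i j : (j < i)%N ->
  exists2 r, ord_lo r = j & (ord_hi r <= i)%N.
Proof.
move=> ji; have rP : (j < n.-1)%N.
  by rewrite ltn_predRL (leq_ltn_trans ji).
by exists (Ordinal rP) => //; apply: val_inj.
Qed.

End ConsecutiveGenerators.

(** The relation b p b^-1 = q p from commutations alone: as q commutes with a,
    the first hypothesis gives a^-1 p a = p q^-1, so that conjugating p by
    b a^-1 gives b p b^-1 q^-1, while by the last hypothesis it gives
    q p q^-1. *)
Lemma commutator_twist (G : groupType) (a b p q : G) :
  a * p = p * q * a -> commute q a -> commute q b ->
  commute (q^-1 * b * a^-1) p -> b * p = q * p * b.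
Proof.
move=> ap qa qb cp.
have pa : a^-1 * p = p * q^-1 * a^-1.
  apply: (mulIg (a * q)); rewrite -[RHS]mulgA mulKg mulgVK -qa.
  by rewrite -mulgA [p * _]mulgA -ap mulKg.
have : q^-1 * b * p * q^-1 * a^-1 = p * q^-1 * b * a^-1.
  rewrite -[LHS]mulgA -[LHS]mulgA [p * (_ * _)]mulgA -pa [LHS]mulgA.
  by rewrite cp !mulgA.
have qVb : q^-1 * b = b * q^-1 := commute_sym (commuteV (commute_sym qb)).
move=> /mulIg; rewrite -[RHS]mulgA qVb [RHS]mulgA => /mulIg e.
by apply: (mulgI q^-1); rewrite mulgA qVb e -!mulgA mulKg.
Qed.

(** * Groups in which commutations lift *)

Section CommutatorLifting.
Variables (n : nat) (G : groupType).
Local Notation F := (free_group 'I_n).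
Local Notation x := (@fgen 'I_n).
Variables (phi : {multiplicative G -> Aut F}) (c : 'I_n.-1 + 'I_n.-1 -> G).
Hypothesis phi_gen : forall s, phi (c s) = ab_gen s.
Hypothesis phi_comm : forall p q, commute (phi p) (phi q) -> commute p q.
Implicit Types (t : bool) (r : 'I_n.-1) (i j k : 'I_n) (u v : F).

(** Families on 'I_n.-1 are extended to nat by the default value 1, so that the
    lifts can be defined by recursion on the distance between the indices. *)
Definition gen_at (f : 'I_n.-1 -> G) (j : nat) : G := oapp f 1 (insub j).

(** [root_below t i d] lifts the transvection of x_i by x_(i-1-d).  The base
    case is b^-1 for t = true because transvections on the left multiply by the
    inverse; the recursive case comes from a p a^-1 = p q. *)
Fixpoint root_below t (i d : nat) : G :=
  if d is d'.+1 then
    [~ root_below t i d', (gen_at (c \o inl) (i.-2 - d'))^-1]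
  else gen_at (fun r => if t then (c (inr r))^-1 else c (inl r)) i.-1.

Definition root t (i j : nat) : G := root_below t i (i.-1 - j).

Lemma gen_atE f r : gen_at f r = f r.
Proof. by rewrite /gen_at valK. Qed.

Lemma root_top t r :
  root t (ord_hi r) (ord_lo r) = if t then (c (inr r))^-1 else c (inl r).
Proof. by rewrite /root /= subnn /= gen_atE. Qed.

Lemma root_step t i r : (ord_hi r < i)%N ->
  root t i (ord_lo r) = [~ root t i (ord_hi r), (c (inl r))^-1].
Proof.
case: i => [[|[|i]] lt_in] //= ri; rewrite /root /=.
rewrite !ltnS in ri.
by rewrite subSn //= subKn // gen_atE subSS.
Qed.

(** With p the transvection by x_k, and a mapping x_k to x_k x_l, the
    commutator p^-1 (a p a^-1) is the transvection by x_k^-1 (x_k x_l). *)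
Lemma phi_root t i j : (j < i)%N -> phi (root t i j) = transv t i (x j).
Proof.
have [d] := ubnP (i - j); elim: d j => // d IH j le_d ji.
have [r rj] := ord_lo_surj ji; rewrite leq_eqVlt => /orP[/eqP/val_inj ri|ri].
  rewrite -rj -ri root_top; case: (t); rewrite ?morph_inv phi_gen /=.
    by rewrite /b_gen e_transv invgK.
  exact: d_transv.
have lt_d : (i - ord_hi r < d)%N.
  by move: le_d; rewrite -rj -ltnS /= subnSK // (leq_trans _ ri) //= ltnS.
rewrite -rj root_step // !gmulfM !morph_inv (IH _ lt_d ri) phi_gen invgK.
rewrite !mulgA; apply: (mulIg (ab_gen (inl r))); rewrite mulgVK.
rewrite -mulgA (lower_transvJ _ _ (lower_ab_gen (s := inl r) ri)) /=.
by rewrite a_gen_hi transvM mulgA mulKg.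
Qed.

Definition root_word t i : F -> G :=
  fg_lift (fun j => if (j < i)%N then root t i j else 1).

HB.instance Definition _ t i := Multiplicative.on (root_word t i).

Lemma root_word_lt t i j : (j < i)%N -> root_word t i (x j) = root t i j.
Proof. by move=> ji; rewrite /root_word fg_lift_gen ji. Qed.

Lemma root_word_ge t i j : (i <= j)%N -> root_word t i (x j) = 1.
Proof. by move=> ij; rewrite /root_word fg_lift_gen ltnNge ij. Qed.

Lemma root_word_low t i u : root_word t i (low_part i u) = root_word t i u.
Proof.
apply: (fg_ext (f := root_word t i \o low_part i)) => k /=.
case: (ltnP k i) => ki; first by rewrite low_part_lt.
by rewrite low_part_ge // morph1 root_word_ge.
Qed.

Lemma phi_root_word t i u : phi (root_word t i u) = transv t i u.
Proof.
rewrite -root_word_low; have <- : transv t i (low_part i u) = transv t i u.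
  apply: aut_gen_ext => k; have [->|ki] := eqVneq k i.
    by rewrite !transv_eq /transv_val low_partK.
  by rewrite !transv_neq.
rewrite -[RHS]/((transv t i \o low_part i) u).
apply: (fg_ext (f := phi \o (root_word t i \o low_part i))) => k /=.
case: (ltnP k i) => ki.
  by rewrite low_part_lt // root_word_lt ?phi_root.
by rewrite low_part_ge // !morph1.
Qed.

(** The heart of the proof.  If the automorphism under c s fixes x_j, this is a
    commutation.  Otherwise j = r + 1: for a_r it is the definition of the
    lifts, and for b_r it is [commutator_twist], whose hypotheses are
    commutations. *)
Lemma rootJ t i s j : (j < i)%N -> (ord_hi (gen_row s) < i)%N ->
  c s * root t i j = root_word t i (ab_gen s (x j)) * c s.
Proof.
move=> ji si; have lo := lower_ab_gen si.
have [ej|nej] := eqVneq j (ord_hi (gen_row s)); last first.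
  rewrite ab_gen_neq // root_word_lt //; apply: phi_comm.
  by rewrite phi_gen phi_root // /commute lower_transvJ // ab_gen_neq.
have li : (ord_lo (gen_row s) < i)%N := ltn_trans (ord_lo_hi _) si.
have {ji} -> := ej.
have row s' : gen_row s' = gen_row s ->
    commute (root t i (ord_lo (gen_row s))) (c s').
  move=> es'; apply/commute_sym/phi_comm; rewrite phi_gen phi_root // -es'.
  by rewrite /commute lower_transvJ ?ab_gen_lo //; apply: lower_ab_gen;
     rewrite es'.
have a_root r : gen_row s = r -> c (inl r) * root t i (ord_hi r) =
    root t i (ord_hi r) * root t i (ord_lo r) * c (inl r).
  move=> sr; rewrite root_step -?sr // !mulgA invgK.
  by rewrite mulgV mul1g mulgVK.
case: s si lo ej li row a_root => r /= si lo _ li row a_root.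
  by rewrite a_gen_hi gmulfM /= !root_word_lt // a_root.
rewrite b_gen_hi gmulfM /= !root_word_lt //.
apply: (commutator_twist (a_root r erefl)); [exact: row | exact: row |].
apply: phi_comm; rewrite !gmulfM !morph_inv !phi_gen.
rewrite (phi_root t (j := ord_hi r) si) (phi_root t (j := ord_lo r) li) /=.
have loa : lower_aut i (a_gen r) := lower_ab_gen (s := inl r) si.
have [_ loM loV] := lower_aut_subgroup i.
(* b a^-1 sends x_k to x_l x_k x_l^-1; the outer factors are cancelled by q. *)
have hx : aut_fun (b_gen r * (a_gen r)^-1) (x (ord_hi r)) =
    x (ord_lo r) * x (ord_hi r) * (x (ord_lo r))^-1.
  rewrite aut_mulE -b_gen_hi.
  have -> : aut_fun (a_gen r)^-1 (x (ord_hi r)) =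
      x (ord_hi r) * (x (ord_lo r))^-1.
    rewrite -[in LHS](mulgK (x (ord_lo r)) (x (ord_hi r))) -a_gen_hi.
    rewrite -{1}[(x (ord_lo r))^-1](_ : a_gen r (x (ord_lo r))^-1 = _).
      by rewrite -autM -aut_mulE mulVg.
    by rewrite autV; congr _^-1; exact: (ab_gen_lo (inl r)).
  by rewrite autM autV; congr (_ * _^-1); exact: (ab_gen_lo (inr r)).
rewrite /commute -[_ * b_gen r * _]mulgA -[LHS]mulgA.
rewrite (lower_transvJ _ _ (loM _ _ lo (loV _ loa))) hx.
by rewrite !transvM morph_inv !mulgA mulVg mul1g.
Qed.

Lemma root_wordJ t i s u : (ord_hi (gen_row s) < i)%N ->
  c s * root_word t i u = root_word t i (ab_gen s u) * c s.
Proof.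
move=> si; move: u; apply: fg_subgroup_full => [|k]; first split.
- by rewrite aut1 !morph1 mulg1 mul1g.
- by move=> u v cu cv; rewrite autM !gmulfM /= mulgA cu -!mulgA cv.
- move=> u cu; rewrite autV !morph_inv /=.
  apply: (mulgI (root_word t i (ab_gen s u))); rewrite mulVKg mulgA -cu.
  by rewrite mulgK.
case: (ltnP k i) => ki; first by rewrite root_word_lt // rootJ.
rewrite ab_gen_neq ?root_word_ge ?mulg1 ?mul1g //.
by rewrite -val_eqE neq_ltn (leq_trans si ki) orbT.
Qed.

Lemma root_wordJV t i s u : (ord_hi (gen_row s) < i)%N ->
  (c s)^-1 * root_word t i u =
    root_word t i (aut_fun (ab_gen s)^-1 u) * (c s)^-1.
Proof.
move=> si; apply: (mulgI (c s)); rewrite mulVKg mulgA root_wordJ //.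
by rewrite -aut_mulE mulgV mulgK.
Qed.

Lemma root_word_comm i u v :
  commute (root_word false i u) (root_word true i v).
Proof. by apply: phi_comm; rewrite !phi_root_word; apply: transv_comm. Qed.

(** The index i is the element of 'I_n with value m'; asking for its existence
    includes the bound m' < n. *)
Fixpoint normal_form (m : nat) (g : G) : Prop :=
  if m is m'.+1 then
    exists i u v h, [/\ i = m' :> nat, normal_form m' h
                      & g = root_word false i u * root_word true i v * h]
  else g = 1.

Lemma normal_form1 m : (m <= n)%N -> normal_form m 1.
Proof.
elim: m => //= m IH lt_mn; exists (Ordinal lt_mn), 1, 1, 1; split=> //.
  exact/IH/ltnW.
by rewrite !morph1 !mulg1.
Qed.

(** A generator of the top layer is absorbed by one of the two leading factors;
    the two commute, so b_r can cross the first one to reach the second.  A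
    generator of a lower layer moves right past both of them, acting on the
    multipliers. *)
Lemma normal_formM m s g : (ord_hi (gen_row s) < m)%N -> normal_form m g ->
  normal_form m (c s * g) /\ normal_form m ((c s)^-1 * g).
Proof.
elim: m g => // m IH g; rewrite ltnS leq_eqVlt.
move=> le_sm [i [u [v [h [im nh ->]]]]]; case/orP: le_sm => [/eqP sm|lt_sm].
  have {sm} ei : i = ord_hi (gen_row s) by apply: val_inj; rewrite /= im -sm.
  have top t : root_word t i (x (ord_lo (gen_row s))) =
      if t then (c (inr (gen_row s)))^-1 else c (inl (gen_row s)).
    by rewrite ei root_word_lt ?ord_lo_hi // root_top.
  case: s {IH} ei top => r /= ei top.
    split; [exists i, (x (ord_lo r) * u), v, h |
            exists i, ((x (ord_lo r))^-1 * u), v, h].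
      by split=> //; rewrite gmulfM /= (top false) !mulgA.
    by split=> //; rewrite gmulfM morph_inv /= (top false) !mulgA.
  (* b_r is the inverse of the lift of the transvection on the left. *)
  split; [exists i, u, ((x (ord_lo r))^-1 * v), h |
          exists i, u, (x (ord_lo r) * v), h].
    split=> //; rewrite -(invgK (c (inr r))) -(top true) -morph_inv.
    by rewrite !mulgA -root_word_comm -[_ * _ * root_word _ _ _]mulgA -gmulfM.
  split=> //; rewrite -(top true).
  by rewrite !mulgA -root_word_comm -[_ * _ * root_word _ _ _]mulgA -gmulfM.
have [n1 n2] := IH h lt_sm nh; rewrite -im in lt_sm.
split.
  exists i, (ab_gen s u), (ab_gen s v), (c s * h); split=> //.
  rewrite !mulgA root_wordJ // -[_ * c s * root_word _ _ _]mulgA.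
  by rewrite root_wordJ // !mulgA.
exists i, (aut_fun (ab_gen s)^-1 u), (aut_fun (ab_gen s)^-1 v), ((c s)^-1 * h).
split=> //; rewrite !mulgA root_wordJV //.
by rewrite -[_ * (c s)^-1 * root_word _ _ _]mulgA root_wordJV // !mulgA.
Qed.

(** Left multiplication by the image of a word preserves normal forms, and 1 has
    one. *)
Lemma normal_form_lift (w : free_group ('I_n.-1 + 'I_n.-1)%type) :
  normal_form n (fg_lift c w).
Proof.
rewrite -[fg_lift c w]mulg1; have : normal_form n 1 by exact: normal_form1.
move: (1 : G) => g; move: g.
pose H : set G := fun p => forall g, normal_form n g ->
  normal_form n (p * g) /\ normal_form n (p^-1 * g).
suff Hw : H (fg_lift c w) by move=> g /Hw[].
apply: fg_lift_in => [|s g]; last exact: normal_formM.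
split=> [g|p q Hp Hq g ng|p Hp g /Hp[]]; rewrite ?invg1 ?mul1g ?invgK //.
rewrite invgM -!mulgA; split; first by have [] := Hp _ (Hq _ ng).1.
by have [] := Hq _ (Hp _ ng).2.
Qed.

Lemma lower_normal_form m i g : (m <= i)%N -> normal_form m g ->
  lower_aut i (phi g).
Proof.
have [lo1 loM _] := lower_aut_subgroup i.
elim: m g => [g _ -> | m IH g mi [j [u [v [h [jm nh ->]]]]]].
  by rewrite morph1.
rewrite !gmulfM !phi_root_word; apply: (loM); last exact/IH/nh/ltnW.
by apply: loM; apply: lower_transv; rewrite jm.
Qed.

(** The top layer fixes F_(<i) pointwise and the lower layers preserve it, so if
    the product acts trivially then so do the lower layers, and hence also the
    top one. *)
Lemma normal_form_inj m g : normal_form m g -> phi g = 1 -> g = 1.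
Proof.
elim: m g => [|m IH] g //= [i [u [v [h [im nh ->]]]]].
rewrite !gmulfM !phi_root_word => e.
have phi_h : phi h = 1.
  have [hx hl] : lower_aut i (phi h) by apply: lower_normal_form nh; rewrite im.
  apply: aut_gen_ext => k; case: (ltnP k i) => [ki|]; last exact: hx.
  have := congr1 (fun a : Aut F => a (x k)) e; rewrite !aut_mulE /=.
  by rewrite -(low_part_lt ki) hl !transv_low.
have [lu lv] : low_part i u = 1 /\ low_part i v = 1.
  by apply: transv_indep; move: e; rewrite phi_h mulg1.
rewrite (IH _ nh phi_h) -root_word_low lu -(root_word_low _ _ v) lv.
by rewrite !morph1 !mulg1.
Qed.

End CommutatorLifting.

(** * Presentations by commutators *)

Section PresentedLift.
Variables (X : choiceType) (G : groupType) (f : X -> G).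
Variable R : set (free_group X).
Hypothesis fR : forall r, R r -> fg_lift f r = 1.

Lemma normal_closure_lift r : normal_closure R r -> fg_lift f r = 1.
Proof.
move/(_ (fun r => fg_lift f r = 1)); apply; split; last exact: fR.
split; first split.
- exact: morph1.
- by move=> p q fp fq; rewrite /= gmulfM /= fp fq mulg1.
- by move=> p fp; rewrite /= morph_inv /= fp invg1.
- by move=> p q fp; rewrite /= conjgE !gmulfM morph_inv /= fp mul1g mulVg.
Qed.

Definition presented_lift (g : presented R) : G := fg_lift f (repr g).

Lemma presented_lift_proj u : presented_lift (pr_proj R u) = fg_lift f u.
Proof.
have /pr_projP/normal_closure_lift := esym (pr_reprK (pr_proj R u)).
by rewrite gmulfM morph_inv /= => e; apply: (mulgI (fg_lift f u)^-1);
   rewrite mulVg.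
Qed.

Lemma presented_liftM : {morph presented_lift : p q / p * q}.
Proof.
move=> p q; rewrite -(pr_reprK p) -(pr_reprK q).
by rewrite -[_ * _]pr_projM !presented_lift_proj gmulfM.
Qed.

End PresentedLift.

HB.instance Definition _ (X : choiceType) (R : set (free_group X)) :=
  isMultiplicative.Build (free_group X) (presented R) (pr_proj R)
    (@pr_projM X R).

(** A group has a presentation by commutators as soon as each cover of it in
    which commuting images force commuting elements is injective on the subgroup
    generated by the lifts: the group presented by all the commutators that are
    trivial in G is such a cover. *)
Lemma presents_commutators (X : choiceType) (G : groupType) (H : set G)
    (g : X -> G) :
  H = range (fg_lift g) ->
  (forall (P : groupType) (phi : {multiplicative P -> G}) (c : X -> P),
     (forall x, phi (c x) = g x) ->
     (forall p q, commute (phi p) (phi q) -> commute p q) ->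
     forall w, phi (fg_lift c w) = 1 -> fg_lift c w = 1) ->
  exists R : set (free_group X),
    (forall r, R r -> exists p q, r = [~ p, q]) /\ presents R H g.
Proof.
move=> -> univ.
pose R r := fg_lift g r = 1 /\ exists p q : free_group X, r = [~ p, q].
exists R; split=> [r []//|].
have gR r : R r -> fg_lift g r = 1 by case.
pose mphi := isMultiplicative.Build _ _ _ (presented_liftM gR).
pose phi : {multiplicative presented R -> G} :=
  HB.pack (@presented_lift X G g R) mphi.
have phiE u : phi (pr_proj R u) = fg_lift g u by apply: presented_lift_proj.
have liftE w : fg_lift (pr_gen R) w = pr_proj R w.
  by apply: (fg_ext (g := pr_proj R)) => k; apply: fg_lift_gen.
have phi_gen k : phi (pr_gen R k) = g k by rewrite phiE fg_lift_gen.
have rel1 r : R r -> pr_proj R r = 1.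
  move=> Rr; apply/esym; rewrite -[LHS](morph1 (pr_proj R)).
  by apply/pr_projP; rewrite invg1 mul1g; apply: sub_normal_closure.
exists phi; split=> //.
- have ker w : phi (pr_proj R w) = 1 -> pr_proj R w = 1.
    rewrite -liftE; apply: univ => // p q.
    rewrite -(pr_reprK p) -(pr_reprK q) !phiE.
    move: (repr p) (repr q) => u v gC.
    apply/commgP/eqP; rewrite -(@rel1 [~ u, v]).
      by rewrite /commg /conjg !gmulfM !morph_inv.
    split; last by exists u, v.
    by rewrite /commg /conjg !gmulfM !morph_inv /=; apply/eqP/commgP.
  move=> p q epq; apply: (mulgI p^-1); rewrite mulVg.
  apply/esym; rewrite -(pr_reprK (p^-1 * q)); apply: ker.
  by rewrite pr_reprK gmulfM morph_inv epq mulVg.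
- apply/seteqP; split=> [_ [p _ <-]|_ [u _ <-]].
    by exists (repr p) => //; rewrite -phiE pr_reprK.
  by exists (pr_proj R u).
Qed.

(** Those d_(i,j) and e_(i,j) whose indices are not consecutive are images of
    the iterated commutators [root], taken in the free group itself. *)
Lemma AplusE n : @Aplus n = range (fg_lift (@ab_gen n)).
Proof.
have phi_gen s : fg_lift (@ab_gen n) (fgen s) = ab_gen s by apply: fg_lift_gen.
apply/seteqP; split=> [a|_ [w _ <-] H [Hs dH]].
  apply; split=> [|_ [i [j [ji [] ->]]]].
  - split=> [|_ _ [u _ <-] [v _ <-]|_ [u _ <-]].
    + by exists 1 => //; apply: morph1.
    + by exists (u * v) => //; rewrite gmulfM.
    + by exists u^-1 => //; rewrite morph_inv.
  - by rewrite d_transv -(phi_root phi_gen).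
  - by rewrite e_transv -(phi_root phi_gen) // -morph_inv.
apply: fg_lift_in Hs _ => -[] r; apply: dH; exists (ord_hi r), (ord_lo r).
  by exists (ord_lo_hi r); left.
by exists (ord_lo_hi r); right.
Qed.

Theorem corollary3 (n : nat) (hn : (2 <= n)%N) :
  exists R : set (free_group ('I_n.-1 + 'I_n.-1)%type),
    (forall r, R r ->
       exists p q : free_group ('I_n.-1 + 'I_n.-1)%type, r = [~ p, q]%g) /\
    presents R (@Aplus n) (@ab_gen n).
Proof.
apply: presents_commutators => [|P phi c phi_gen phi_comm w]; last first.
  exact/(normal_form_inj phi_gen)/(normal_form_lift phi_gen phi_comm).
exact: AplusE.
Qed.
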